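(* Let $S(\Sigma,Q,\eta)$ be a unital product entity. Let $\mathcal L=\{a(\alpha)\mid\alpha\in Q\}$, partially ordered by $a(\alpha)<a(\beta)\Leftrightarrow\alpha<\beta$ $(\alpha,\beta\in Q)$, and let $\xi:\Sigma\to\mathcal P(\mathcal L)$, $\xi(p)=\{a(\alpha)\mid\alpha\in\eta(p)\}$. Then the triple $(\Sigma,\mathcal L,\xi)$ is a state property system. The top and bottom elements of $\mathcal L$ are $I=a(\tau)$ and $0=a(\delta)$, where $\tau$ is a unit test and $\delta$ is a zero test.
   Context: All orders written $<$ are reflexive (non-strict). A state test entity $S(\Sigma,Q,\eta)$ consists of a set $\Sigma$ (states), a set $Q$ (tests) and a function $\eta:\Sigma\to\mathcal P(Q)$. On $Q$ define the pre-order $\alpha<\beta\Leftrightarrow$ (for all $p\in\Sigma$, $\alpha\in\eta(p)$ implies $\beta\in\eta(p)$). On $\Sigma$ define the pre-order $p<q\Leftrightarrow\eta(q)\subset\eta(p)$. A product test of a family $(\alpha_i)_i$ in $Q$ is a test $\Pi_i\alpha_i\in Q$ such that for all $p\in\Sigma$: $\Pi_i\alpha_i\in\eta(p)\Leftrightarrow\alpha_i\in\eta(p)$ for all $i$. A unit test is a $\tau\in Q$ with $\tau\in\eta(p)$ for all $p\in\Sigma$; a zero test is a $\delta\in Q$ with $\delta\notin\eta(p)$ for all $p\in\Sigma$. The entity is a unital product entity if $Q$ contains a unit test, a zero test, and a product test for each family in $Q$. Tests are equivalent, $\alpha\approx\beta$, if $\alpha<\beta$ and $\beta<\alpha$; $a(\alpha)=\{\beta\in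 Q\mid\beta\approx\alpha\}$ denotes the equivalence class of $\alpha$. A state property system $(\Sigma,\mathcal L,\xi)$ consists of a pre-ordered set $(\Sigma,<)$, a complete lattice $(\mathcal L,<,\wedge,\vee)$ with maximal element $I$ and minimal element $0$, and a function $\xi:\Sigma\to\mathcal P(\mathcal L)$ such that for all $p\in\Sigma$ and all families $(a_i)_i$ in $\mathcal L$: $I\in\xi(p)$; $0\notin\xi(p)$; ($a_i\in\xi(p)$ for all $i$) $\Leftrightarrow$ $\wedge_i a_i\in\xi(p)$; and for $p,q\in\Sigma$, $a,b\in\mathcal L$: $p<q\Leftrightarrow\xi(q)\subset\xi(p)$; $a<b\Leftrightarrow$ (for all $r\in\Sigma$, $a\in\xi(r)$ implies $b\in\xi(r)$). *)

(* Defs.v *)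
From Corelib Require Import Relation_Definitions.
From mathcomp Require Import all_boot.
From mathcomp Require Import boolp classical_sets.

Set Implicit Arguments.
Unset Strict Implicit.
Unset Printing Implicit Defensive.

Local Open Scope classical_set_scope.

(** A state test entity is given by its map [eta : Sigma -> set Q].  Every order
    relation below is reflexive, although written "less than" in the
    literature.  Families are indexed by arbitrary types, the empty type
    included. *)

Section StateTestEntity.
Variables (Sigma Q : Type) (eta : Sigma -> set Q).

Definition test_le : relation Q :=
  fun alpha beta => forall p, eta p alpha -> eta p beta.

Definition state_le : relation Sigma := fun p q => eta q `<=` eta p.

Definition is_product_test (J : Type) (alpha : J -> Q) (pi : Q) : Prop :=
  forall p, eta p pi <-> forall j, eta p (alpha j).

Definition is_unit_test (tau : Q) : Prop := forall p, eta p tau.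

Definition is_zero_test (delta : Q) : Prop := forall p, ~ eta p delta.

Record unital_product_entity : Prop := {
  upe_unit : exists tau, is_unit_test tau;
  upe_zero : exists delta, is_zero_test delta;
  upe_product : forall (J : Type) (alpha : J -> Q),
    exists pi, is_product_test alpha pi }.

Definition test_equiv : relation Q :=
  fun alpha beta => test_le alpha beta /\ test_le beta alpha.

Definition test_class (alpha : Q) : set Q := [set beta | test_equiv beta alpha].

Definition property : Type := set_type (range test_class).

Definition property_of (alpha : Q) : property :=
  SigSub (mem_set (imageT test_class alpha)).

(** The order on properties is given through representatives; that it does not
    depend on their choice is not part of the definition. *)
Definition property_le : relation property :=
  fun a b => exists alpha beta,
    [/\ a = property_of alpha, b = property_of beta & test_le alpha beta].

Definition actual_properties (p : Sigma) : set property :=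
  property_of @` eta p.

End StateTestEntity.

Arguments property_le {Sigma Q} eta.
Arguments actual_properties {Sigma Q} eta.

Section CompleteLattice.
Variables (L : Type) (le : relation L).

Definition is_greatest (t : L) : Prop := forall a, le a t.

Definition is_least (b : L) : Prop := forall a, le b a.

Definition is_meet (J : Type) (a : J -> L) (m : L) : Prop :=
  (forall j, le m (a j)) /\ forall c, (forall j, le c (a j)) -> le c m.

Definition is_join (J : Type) (a : J -> L) (s : L) : Prop :=
  (forall j, le (a j) s) /\ forall c, (forall j, le (a j) c) -> le s c.

Record complete_lattice : Prop := {
  cl_order : Relation_Definitions.order L le;
  cl_meet : forall (J : Type) (a : J -> L), exists m, is_meet a m;
  cl_join : forall (J : Type) (a : J -> L), exists s, is_join a s }.

End CompleteLattice.

(** Meets and extrema are referred to through their defining properties rather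
    than as operations: in a complete lattice they exist (the extrema as the
    meet and the join of the empty family) and are unique. *)
Record state_property_system (Sigma : Type) (leS : relation Sigma)
    (L : Type) (leL : relation L) (xi : Sigma -> set L) : Prop := {
  sps_preorder : Relation_Definitions.preorder Sigma leS;
  sps_lattice : complete_lattice leL;
  sps_top : forall (p : Sigma) (I : L), is_greatest leL I -> xi p I;
  sps_bot : forall (p : Sigma) (O : L), is_least leL O -> ~ xi p O;
  sps_meet : forall (p : Sigma) (J : Type) (a : J -> L) (m : L),
    is_meet leL a m -> ((forall j, xi p (a j)) <-> xi p m);
  sps_state_le : forall p q : Sigma, leS p q <-> xi q `<=` xi p;
  sps_property_le : forall a b : L,
    leL a b <-> forall r : Sigma, xi r a -> xi r b }.

(* Main.v *)
(** A test [alpha] lies in [eta p] iff its class lies in [xi p], so the order on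
    classes is inclusion of the sets of states in which they are actual. The
    class of a product test is therefore a meet, and a meet is actual exactly
    when all its members are. Joins are meets of upper bounds. *)

Require Import Defs.
From mathcomp Require Import all_boot.
From mathcomp Require Import boolp classical_sets.

Set Implicit Arguments.
Unset Strict Implicit.
Unset Printing Implicit Defensive.

Local Open Scope classical_set_scope.

Section Properties.
Variables (Sigma Q : Type) (eta : Sigma -> set Q).

Local Notation "[ 'prop' a ]" := (property_of eta a) (format "[ 'prop'  a ]").
Local Notation leL := (property_le eta).
Local Notation xi := (actual_properties eta).

Lemma test_le_trans alpha beta gamma :
  test_le eta alpha beta -> test_le eta beta gamma -> test_le eta alpha gamma.
Proof. by move=> ab bc p /ab /bc. Qed.

Lemma property_of_eq alpha beta :
  [prop alpha] = [prop beta] <-> test_equiv eta alpha beta.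
Proof.
split=> [/(congr1 val) /= e | [ab ba]].
  (* By reflexivity [alpha] lies in its own class, which [e] identifies with that of [beta]. *)
  suff : test_class eta beta alpha by [].
  by rewrite -e; split=> p.
apply: val_inj => /=; apply/seteqP; split=> gamma [h1 h2]; split.
- exact: test_le_trans ab.
- exact: test_le_trans h2.
- exact: test_le_trans ba.
- exact: test_le_trans h2.
Qed.

Lemma property_of_surj (a : property eta) : exists alpha, a = [prop alpha].
Proof.
case: a => a a_in; case: (set_mem a_in) => alpha _ e.
by exists alpha; apply: val_inj.
Qed.

(** Actuality does not depend on the representative: equivalent tests lie in the same sets
    [eta p]. *)
Lemma actual_property_of p alpha : xi p [prop alpha] <-> eta p alpha.
Proof.
split=> [[beta pb /property_of_eq[ba _]] | pa]; first exact: ba.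
by exists alpha.
Qed.

(** Independence of representatives: the witnesses hidden in [property_le] are equivalent to [alpha]
    and [beta], so transitivity carries the comparison over. *)
Lemma property_le_of alpha beta :
  leL [prop alpha] [prop beta] <-> test_le eta alpha beta.
Proof.
split=> [[a [b [/property_of_eq[h1 _] /property_of_eq[_ h2] ab]]] | ab].
  exact: test_le_trans h1 (test_le_trans ab h2).
by exists alpha, beta.
Qed.

Lemma property_le_actual a b : leL a b <-> forall r, xi r a -> xi r b.
Proof.
have [alpha ->] := property_of_surj a; have [beta ->] := property_of_surj b.
rewrite property_le_of; split=> ab p.
  by rewrite !actual_property_of; apply: ab.
by have := ab p; rewrite !actual_property_of.
Qed.

Lemma property_le_order : Relation_Definitions.order _ leL.
Proof.
split=> [a | a b c | a b].
- by apply/property_le_actual.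
- rewrite !property_le_actual => ab bc p pa; exact: bc (ab p pa).
(* Antisymmetry: mutual comparison of representatives is precisely equivalence, so the classes
   coincide. *)
have [alpha ->] := property_of_surj a; have [beta ->] := property_of_surj b.
by rewrite !property_le_of => ab ba; apply/property_of_eq.
Qed.

Lemma unit_test_greatest tau : is_unit_test eta tau -> is_greatest leL [prop tau].
Proof.
move=> tauP a; apply/property_le_actual => p _.
exact/actual_property_of.
Qed.

Lemma zero_test_least delta : is_zero_test eta delta -> is_least leL [prop delta].
Proof.
move=> deltaP a; apply/property_le_actual => p /actual_property_of pd.
by case: (deltaP p).
Qed.

Hypothesis hS : unital_product_entity eta.

(** The witness is the class of a product test of chosen representatives. Its actuality is recorded
    along with the meet property, for later transfer to arbitrary meets. *)
Lemma exists_actual_meet (J : Type) (a : J -> property eta) :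
  exists m, is_meet leL a m /\ forall p, xi p m <-> forall j, xi p (a j).
Proof.
have [alpha aE] := choice (fun j => property_of_surj (a j)).
have [pi piP] := upe_product hS alpha.
have mP p : xi p [prop pi] <-> forall j, xi p (a j).
  rewrite actual_property_of; split=> [/piP h j | h].
    by rewrite aE; apply/actual_property_of.
  by apply/piP => j; apply/actual_property_of; rewrite -aE.
exists [prop pi]; split=> //; split=> [j | c cP]; apply/property_le_actual => p.
  by move/mP.
by move=> pc; apply/mP => j; move: (cP j) => /property_le_actual; apply.
Qed.

Lemma actual_meet p (J : Type) (a : J -> property eta) m :
  is_meet leL a m -> (forall j, xi p (a j)) <-> xi p m.
Proof.
(* The meet [n] built above is a lower bound, hence below [m]; so [m] is actual whenever [n] is. The
   converse uses only that [m] is a lower bound. *)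
move=> [m_lb m_glb]; have [n [[n_lb _] nP]] := exists_actual_meet a; split.
  by move=> /nP; have /property_le_actual := m_glb n n_lb; apply.
by move=> pm j; have /property_le_actual := m_lb j; apply.
Qed.

Lemma exists_join (J : Type) (a : J -> property eta) : exists s, is_join leL a s.
Proof.
(* Meets are taken over families, so the upper bounds are packed into an index type. *)
pose ub := {c | forall j, leL (a j) c}.
have [s [[s_lb s_glb] _]] := exists_actual_meet (fun c : ub => sval c).
exists s; split=> [j | c cP]; first by apply: s_glb => -[c cP] /=.
exact: s_lb (exist _ c cP).
Qed.

Lemma property_complete_lattice : complete_lattice leL.
Proof.
split=> [| J a |]; [exact: property_le_order | | exact: exists_join].
by have [m [mP _]] := exists_actual_meet a; exists m.
Qed.

Lemma property_state_property_system :
  state_property_system (state_le eta) leL xi.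
Proof.
split.
- by split=> [p | p q r pq qr] //; apply: subset_trans pq.
- exact: property_complete_lattice.
(* A greatest [I] lies above the class of a unit test, which is actual in every state. *)
- move=> p I Imax; have [tau tauP] := upe_unit hS.
  have /property_le_actual := Imax [prop tau]; apply.
  exact/actual_property_of.
(* Dually, if a least [O] were actual in [p], so would be the class of a zero test. *)
- move=> p O Omin pO; have [delta deltaP] := upe_zero hS.
  have /property_le_actual h := Omin [prop delta].
  by move: (h p pO) => /actual_property_of; apply: deltaP.
- by move=> p J a m; apply: actual_meet.
- move=> p q; split=> [pq _ [alpha /pq pa <-] | pq alpha].
    by exists alpha.
  by move=> /actual_property_of /pq /actual_property_of.
- exact: property_le_actual.
Qed.

End Properties.

Theorem theorem1 (Sigma Q : Type) (eta : Sigma -> set Q)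
    (hS : unital_product_entity eta) :
  (forall alpha beta : Q,
     property_le eta (property_of eta alpha) (property_of eta beta)
       <-> test_le eta alpha beta)
  /\ state_property_system (state_le eta) (property_le eta)
       (actual_properties eta)
  /\ (forall tau : Q, is_unit_test eta tau ->
        is_greatest (property_le eta) (property_of eta tau))
  /\ (forall delta : Q, is_zero_test eta delta ->
        is_least (property_le eta) (property_of eta delta)).
Proof.
split; first exact: property_le_of.
split; first exact: property_state_property_system.
by split; [exact: unit_test_greatest | exact: zero_test_least].
Qed.
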